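(* Let $(\mathfrak g,\cdot)$ be a commutative associative algebra and let $D_1,D_2$ be derivations of $(\mathfrak g,\cdot)$ with $D_1D_2=D_2D_1$. Let $N$ be a Nijenhuis operator on $(\mathfrak g,\cdot)$ satisfying $ND_1=D_1N$ and $ND_2=D_2N$. Then $N$ is a Nijenhuis operator on the $3$-Lie algebra $\mathfrak g$ with bracket $$[x,y,z]=\begin{vmatrix}x&y&z\\ D_1(x)&D_1(y)&D_1(z)\\ D_2(x)&D_2(y)&D_2(z)\end{vmatrix},\qquad x,y,z\in\mathfrak g.$$
   Context: The determinant of a $3\times3$ matrix with entries in the commutative associative algebra $(\mathfrak g,\cdot)$ is given by the usual formula using the product of $\mathfrak g$. A linear map $N$ on an associative algebra $(\mathfrak g,\cdot)$ is a Nijenhuis operator if $Nx\cdot Ny=N(Nx\cdot y+x\cdot Ny-N(x\cdot y))$ for all $x,y\in\mathfrak g$. A $3$-Lie algebra is a vector space $\mathfrak g$ with a trilinear skew-symmetric bracket satisfying $[x_1,x_2,[y_1,y_2,y_3]]=[[x_1,x_2,y_1],y_2,y_3]+[y_1,[x_1,x_2,y_2],y_3]+[y_1,y_2,[x_1,x_2,y_3]]$. It is a known fact that the bracket in the claim is a $3$-Lie algebra structure. A linear map $N$ on a $3$-Lie algebra is a Nijenhuis operator if $[Nx,Ny,Nz]=N([x,y,z]_N^2)$ for all $x,y,z$, where $[x,y,z]_N^1=[Nx,y,z]+[x,Ny,z]+[x,y,Nz]-N[x,y,z]$ and $[x,y,z]_N^2=[Nx,Ny,z]+[x,Ny,Nz]+[Nx,y,Nz]-N([x,y,z]_N^1)$.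 *)

(* Defs.v *)
From HB Require Import structures.
From mathcomp Require Import all_boot all_order all_algebra.
From mathcomp Require Import ring.

Set Implicit Arguments.
Unset Strict Implicit.
Unset Printing Implicit Defensive.
Import GRing.Theory.
Local Open Scope ring_scope.

(* An algebra here is a vector space with a bilinear product and need not have
   a unit, which is why MathComp's unital comAlgType is not used. *)

Section AssociativeAlgebra.
Variables (K : fieldType) (V : lmodType K) (mul : {bilinear V -> V -> V}).

Definition derivation (D : {linear V -> V}) : Prop :=
  forall x y, D (mul x y) = mul (D x) y + mul x (D y).

Definition nijenhuis (N : {linear V -> V}) : Prop :=
  forall x y, mul (N x) (N y) = N (mul (N x) y + mul x (N y) - N (mul x y)).

(* Rule of Sarrus. MathComp's \det requires the entries to lie in a unital
   ring. *)
Definition det3 (a b c a' b' c' a'' b'' c'' : V) : V :=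
  mul (mul a b') c'' + mul (mul b c') a'' + mul (mul c a') b''
  - mul (mul c b') a'' - mul (mul b a') c'' - mul (mul a c') b''.

Definition det_bracket (D1 D2 : {linear V -> V}) (x y z : V) : V :=
  det3      x      y      z
       (D1 x) (D1 y) (D1 z)
       (D2 x) (D2 y) (D2 z).

End AssociativeAlgebra.

Record lie3 (K : fieldType) (V : lmodType K) := Lie3 {
  lie3_bracket :> V -> V -> V -> V;
  lie3_linear1 : forall y z, linear (fun x => lie3_bracket x y z);
  lie3_linear2 : forall x z, linear (fun y => lie3_bracket x y z);
  lie3_linear3 : forall x y, linear (fun z => lie3_bracket x y z);
  (* The transpositions (1 2) and (2 3) generate the symmetric group S_3. *)
  lie3_skew12 : forall x y z, lie3_bracket y x z = - lie3_bracket x y z;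
  lie3_skew23 : forall x y z, lie3_bracket x z y = - lie3_bracket x y z;
  lie3_fundamental : forall x1 x2 y1 y2 y3,
    lie3_bracket x1 x2 (lie3_bracket y1 y2 y3) =
      lie3_bracket (lie3_bracket x1 x2 y1) y2 y3
    + lie3_bracket y1 (lie3_bracket x1 x2 y2) y3
    + lie3_bracket y1 y2 (lie3_bracket x1 x2 y3)
}.

Section Lie3Nijenhuis.
Variables (K : fieldType) (V : lmodType K) (L : lie3 V) (N : {linear V -> V}).

Definition lie3_deformed1 (x y z : V) : V :=
  L (N x) y z + L x (N y) z + L x y (N z) - N (L x y z).

Definition lie3_deformed2 (x y z : V) : V :=
  L (N x) (N y) z + L x (N y) (N z) + L (N x) y (N z)
  - N (lie3_deformed1 x y z).

Definition lie3_nijenhuis : Prop :=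
  forall x y z, L (N x) (N y) (N z) = N (lie3_deformed2 x y z).

End Lie3Nijenhuis.

(* Adjoining a unit embeds the algebra into a commutative ring, so that [ring]
   can be used for identities in the non-unital algebra. *)
Section Unitization.
Variables (K : fieldType) (V : lmodType K) (mul : {bilinear V -> V -> V}).
Hypotheses (mulA : associative mul) (mulC : commutative mul).

Definition unitization of associative mul & commutative mul : Type :=
  (K * V)%type.
Local Notation U := (unitization mulA mulC).
HB.instance Definition _ := GRing.Zmodule.on U.

Let mulDl x y z : mul (x + y) z = mul x z + mul y z.
Proof. exact: linearDl. Qed.
Let mulDr x y z : mul x (y + z) = mul x y + mul x z.
Proof. exact: linearDr. Qed.
Let mulZl a x y : mul (a *: x) y = a *: mul x y.
Proof. exact: linearZl_LR. Qed.
Let mulZr a x y : mul x (a *: y) = a *: mul x y.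
Proof. exact: linearZr_LR. Qed.
Let mul0l y : mul 0 y = 0.
Proof. exact: linear0l. Qed.

Definition unitization_one : U := (1, 0).
Definition unitization_mul (u v : U) : U :=
  (u.1 * v.1, u.1 *: v.2 + v.1 *: u.2 + mul u.2 v.2).

Fact unitization_mulA : associative unitization_mul.
Proof.
move=> [a x] [b y] [c z]; congr pair; rewrite /= ?mulrA //.
rewrite !(mulDl, mulDr, mulZl, mulZr, scalerDr, scalerA) mulA.
rewrite (mulrC c a) (mulrC c b) -!addrA; do 2!congr (_ + _).
rewrite [LHS]addrCA; congr (_ + _); rewrite [RHS]addrCA; congr (_ + _).
exact: addrCA.
Qed.

Fact unitization_mulC : commutative unitization_mul.
Proof.
by move=> [a x] [b y]; congr pair; rewrite /= ?(mulrC a) // (mulC x) (addrC (a *: y)).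
Qed.

Fact unitization_mul1 : left_id unitization_one unitization_mul.
Proof.
by move=> [a x]; congr pair; rewrite /= ?mul1r // scale1r scaler0 mul0l !addr0.
Qed.

Fact unitization_mulDl : left_distributive unitization_mul +%R.
Proof.
move=> [a x] [b y] [c z]; congr pair; rewrite /= ?mulrDl //.
by rewrite scalerDl scalerDr mulDl (addrACA (a *: z)) (addrACA (_ + _)).
Qed.

Fact unitization_1neq0 : unitization_one != 0.
Proof. by apply/eqP => /(congr1 fst) /eqP; rewrite oner_eq0. Qed.

HB.instance Definition _ := GRing.Zmodule_isComNzRing.Build U
  unitization_mulA unitization_mulC unitization_mul1 unitization_mulDl
  unitization_1neq0.

Lemma embed_in_ring : exists (R : comNzRingType) (io : V -> R),
  [/\ injective io, {morph io : x y / x + y}, {morph io : x / - x}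
    & {morph io : x y / mul x y >-> x * y}].
Proof.
exists U, (fun x => (0, x)); split=> [x y [] //|x y|x|x y].
- by congr pair; rewrite /= addr0.
- by congr pair; rewrite /= oppr0.
- by congr pair; rewrite /= ?mulr0 // !scale0r !add0r.
Qed.

End Unitization.

Section DetBracket.
Variables (K : fieldType) (V : lmodType K) (mul : {bilinear V -> V -> V}).
Hypotheses (mulA : associative mul) (mulC : commutative mul).
Variables D1 D2 : {linear V -> V}.
Hypotheses (derD1 : derivation mul D1) (derD2 : derivation mul D2).
Hypothesis D12 : D1 \o D2 =1 D2 \o D1.

Local Notation br := (det_bracket mul D1 D2).
Let D12E x : D1 (D2 x) = D2 (D1 x) := D12 x.

Fact det_bracket_skew12 x y z : br y x z = - br x y z.
Proof.
have [R [io [io_inj ioD ioN ioM]]] := embed_in_ring mulA mulC.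
by apply: io_inj; rewrite /det_bracket /det3 !(ioD, ioN, ioM); ring.
Qed.

Fact det_bracket_skew23 x y z : br x z y = - br x y z.
Proof.
have [R [io [io_inj ioD ioN ioM]]] := embed_in_ring mulA mulC.
by apply: io_inj; rewrite /det_bracket /det3 !(ioD, ioN, ioM); ring.
Qed.

Fact det_bracket_linear1 y z : linear (fun x => br x y z).
Proof.
have [R [io [io_inj ioD ioN ioM]]] := embed_in_ring mulA mulC.
move=> a x x'; rewrite /det_bracket /det3 !linearP.
rewrite !(linearDl, linearDr, linearZl_LR, linearZr_LR) /=.
rewrite !(scalerDr, scalerN).
by apply: io_inj; rewrite !(ioD, ioN); ring.
Qed.

Fact det_bracket_linear2 x z : linear (fun y => br x y z).
Proof.
move=> a y y'; rewrite ![br x _ z]det_bracket_skew12.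
by rewrite det_bracket_linear1 opprD scalerN.
Qed.

Fact det_bracket_linear3 x y : linear (fun z => br x y z).
Proof.
move=> a z z'; rewrite ![br x y _]det_bracket_skew23.
by rewrite det_bracket_linear2 opprD scalerN.
Qed.

Fact derivation_det3 (D : {linear V -> V}) (derD : derivation mul D)
    (a b c a' b' c' a'' b'' c'' : V) :
  D (det3 mul a b c a' b' c' a'' b'' c'') =
    det3 mul (D a) (D b) (D c) a' b' c' a'' b'' c''
  + det3 mul a b c (D a') (D b') (D c') a'' b'' c''
  + det3 mul a b c a' b' c' (D a'') (D b'') (D c'').
Proof.
have [R [io [io_inj ioD ioN ioM]]] := embed_in_ring mulA mulC.
have DM x y : D (mul x y) = mul (D x) y + mul x (D y) := derD x y.
have DD : {morph D : x y / x + y} := raddfD D.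
have DN : {morph D : x / - x} := raddfN D.
by apply: io_inj; rewrite /det3 !(DD, DN, DM) !(ioD, ioN, ioM); ring.
Qed.

Fact det_bracket_fundamental x1 x2 y1 y2 y3 :
  br x1 x2 (br y1 y2 y3) =
    br (br x1 x2 y1) y2 y3 + br y1 (br x1 x2 y2) y3 + br y1 y2 (br x1 x2 y3).
Proof.
have [R [io [io_inj ioD ioN ioM]]] := embed_in_ring mulA mulC.
have io_det3 a b c a' b' c' a'' b'' c'' :
    io (det3 mul a b c a' b' c' a'' b'' c'') =
      io a * (io b' * io c'' - io c' * io b'')
    - io b * (io a' * io c'' - io c' * io a'')
    + io c * (io a' * io b'' - io b' * io a'').
  by rewrite /det3 !(ioD, ioN, ioM); ring.
apply: io_inj; rewrite /det_bracket.
rewrite !(derivation_det3 derD1) !(derivation_det3 derD2) !D12E.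
rewrite !(ioD, io_det3).
ring.
Qed.

Definition det_lie3 : lie3 V :=
  Lie3 det_bracket_linear1 det_bracket_linear2 det_bracket_linear3
       det_bracket_skew12 det_bracket_skew23 det_bracket_fundamental.

End DetBracket.

(* Main.v *)
Require Import Defs.
From mathcomp Require Import all_boot all_order all_algebra.
From mathcomp Require Import ring.
Import GRing.Theory.
Local Open Scope ring_scope.

(** The Nijenhuis identity passes from the product [x y] to the triple product
    [x y z], where it takes the ternary form.  That form is linear in the
    trilinear operation, and since [N] commutes with [D1] and [D2], the bracket
    is a signed sum of triple products of elements to which it applies. *)

Lemma nijenhuis_triple {K : fieldType} {V : lmodType K}
    {mul : {bilinear V -> V -> V}}
    (mulA : associative mul) (mulC : commutative mul)
    {N : {linear V -> V}} (nijN : nijenhuis mul N) (x y z : V) :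
  let t a b c := mul (mul a b) c in
  t (N x) (N y) (N z) =
    N (t (N x) (N y) z) + N (t x (N y) (N z)) + N (t (N x) y (N z))
    - N (N (t (N x) y z)) - N (N (t x (N y) z)) - N (N (t x y (N z)))
    + N (N (N (t x y z))).
Proof.
have [R [io [io_inj ioD ioN ioM]]] := embed_in_ring mulA mulC.
have ND : {morph N : u v / u + v} := raddfD N.
have NN : {morph N : u / - u} := raddfN N.
(* With [mul (N x) (N y)] written as [N w], the identity applies again to [w] and [z]; folding [N w]
   back leaves [t (N x) (N y) z]. *)
move=> t; rewrite {1}/t (nijN x y) nijN -(nijN x y).
rewrite !(linearDl, linearNl, linearDr, linearNr) /=.
(* This third use makes the terms [N (N (mul (N (mul x y)) z))] cancel. *)
rewrite (nijN (mul x y) z) !(ND, NN).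
by apply: io_inj; rewrite /t !(ioD, ioN); ring.
Qed.

Theorem proposition4p7 (K : fieldType) (V : lmodType K)
    (mul : {bilinear V -> V -> V})
    (mulA : associative mul) (mulC : commutative mul)
    (D1 D2 : {linear V -> V})
    (derD1 : derivation mul D1) (derD2 : derivation mul D2)
    (D12 : D1 \o D2 =1 D2 \o D1)
    (N : {linear V -> V}) (nijN : nijenhuis mul N)
    (ND1 : N \o D1 =1 D1 \o N) (ND2 : N \o D2 =1 D2 \o N) :
  lie3_nijenhuis (det_lie3 mulA mulC derD1 derD2 D12) N.
Proof.
have [R [io [io_inj ioD ioN ioM]]] := embed_in_ring mulA mulC.
have ND : {morph N : u v / u + v} := raddfD N.
have NN : {morph N : u / - u} := raddfN N.
have D1N u : D1 (N u) = N (D1 u) by rewrite -[LHS]ND1.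
have D2N u : D2 (N u) = N (D2 u) by rewrite -[LHS]ND2.
move=> x y z; rewrite /lie3_deformed2 /lie3_deformed1 /= /det_bracket /det3.
rewrite !(D1N, D2N) !(nijenhuis_triple mulA mulC nijN) !(ND, NN).
(* Without [ioM] the iterated [N]-images of triple products stay atoms, so [ring] only matches
   signed sums. *)
by apply: io_inj; rewrite !(ioD, ioN); ring.
Qed.
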